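(* Consider the ISQA framework described in the context for $\min_xF(x)=f(x)+\Psi(x)$ with an arbitrary $x^0\in\mathcal{H}$. Assume the solution set $\Omega$ is nonempty, $f$ is convex and $L$-smooth for some $L>0$, $\Psi$ is convex, proper and lower semicontinuous, there are $M\ge m>0$ with $MI\succeq H_t\succeq mI$ for all $t$, there is $\eta\in[0,1)$ such that $Q_t(p^t)-Q_t^*\le-\eta Q_t^*$ for all $t$, and there are $\xi,\zeta>0$ and $\theta\in(1/4,1]$ such that $$\zeta\operatorname{dist}(x,\Omega)\le\big(F(x)-F^*\big)^{\theta}\quad\text{for all }x\text{ with }F(x)-F^*\le\xi.$$ Then $x^t\to x^*$ for some $x^*\in\Omega$.
   Context: $\mathcal{H}$ is a Euclidean space; $F^*$ is the minimum value of $F$ and $\Omega$ its set of minimizers; $\operatorname{dist}(x,\Omega)=\min_{y\in\Omega}\|x-y\|$. $f$ is $L$-smooth if differentiable with $L$-Lipschitz gradient. ISQA framework: given $x^0$ and $\gamma,\beta\in(0,1)$, for $t=0,1,\dots$: choose a self-adjoint positive semidefinite linear operator $H_t$; let $Q_t(p):=\langle\nabla f(x^t),p\rangle+\tfrac12\langle p,H_tp\rangle+\Psi(x^t+p)-\Psi(x^t)$ and $Q_t^*:=\min_pQ_t(p)$; compute an approximate minimizer $p^t$; let $\alpha_t$ be the largest element of $\{1,\beta,\beta^2,\dots\}$ with $F(x^t+\alpha_tp^t)\le F(x^t)+\gamma\alpha_tQ_t(p^t)$; set $x^{t+1}=x^t+\alpha_tp^t$.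
   Formalization: The initial point x^0 is required to satisfy Ψ(x^0) < +∞, since otherwise Q_0, which contains Ψ(x^0+p) − Ψ(x^0), is undefined; the Euclidean space is taken as R^n with the standard inner product. *)

(* Defs.v *)
(* H = R^n as row vectors 'rV[R]_n
   with the standard Euclidean inner product. *)
From HB Require Import structures.
From mathcomp Require Import all_boot all_order all_algebra.
From mathcomp Require Import all_classical all_reals all_analysis.
Set Implicit Arguments. Unset Strict Implicit. Unset Printing Implicit Defensive.
Import Order.TTheory GRing.Theory Num.Theory.
Local Open Scope classical_set_scope.
Local Open Scope ring_scope.

Section Defs.
Variables (R : realType) (n : nat).
Notation V := 'rV[R]_n.

Definition dotv (u v : V) : R := \sum_(i < n) u ord0 i * v ord0 i.
Definition normv (u : V) : R := Num.sqrt (dotv u u).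

Definition distv (x : V) (A : set V) : R := inf [set normv (x - y) | y in A].

Definition is_gradient (f : V -> R) (g : V -> V) : Prop :=
  forall x eps, 0 < eps -> exists2 d, 0 < d & forall h, normv h < d ->
    `| f (x + h) - f x - dotv (g x) h | <= eps * normv h.

Definition L_smooth (L : R) (f : V -> R) (g : V -> V) : Prop :=
  is_gradient f g /\ forall x y, normv (g x - g y) <= L * normv (x - y).

Definition convex_fun (f : V -> R) : Prop :=
  forall x y (l : R), 0 <= l <= 1 ->
    f (l *: x + (1 - l) *: y) <= l * f x + (1 - l) * f y.

Definition convex_efun (f : V -> \bar R) : Prop :=
  forall x y (l : R), 0 <= l <= 1 ->
    (f (l *: x + (1 - l) *: y)%R <= l%:E * f x + (1 - l)%:E * f y)%E.

Definition proper_efun (f : V -> \bar R) : Prop :=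
  (forall x, f x != -oo%E) /\ (exists x, (f x < +oo)%E).

Definition lsc_efun (f : V -> \bar R) : Prop :=
  forall x (a : R), (a%:E < f x)%E -> exists2 d, 0 < d &
    forall y, normv (y - x) < d -> (a%:E < f y)%E.

Definition Fobj (f : V -> R) (Psi : V -> \bar R) (x : V) : \bar R :=
  ((f x)%:E + Psi x)%E.
Definition argminset (F : V -> \bar R) : set V :=
  [set x | forall y, (F x <= F y)%E].
Definition minval (F : V -> \bar R) : R := fine (ereal_inf (range F)).

Definition Qmodel (g : V -> V) (Psi : V -> \bar R) (H : 'M[R]_n) (x p : V)
  : \bar R :=
  ((dotv (g x) p + 2^-1 * dotv p (p *m H))%:E + Psi (x + p)%R - Psi x)%E.
Definition Qopt (g : V -> V) (Psi : V -> \bar R) (H : 'M[R]_n) (x : V)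
  : \bar R := ereal_inf (range (Qmodel g Psi H x)).

Definition armijo (F : V -> \bar R) (gam : R) (x p : V) (q : \bar R) (a : R)
  : Prop := (F (x + a *: p)%R <= F x + (gam * a)%:E * q)%E.

End Defs.

(* Main.v *)
(* Write delta_t = F(x^t) - F*.  One iteration decreases F by a constant times
   -Q_t^*, and the squared step length is at most a constant times -Q_t^*.
   Testing the model along the segment to a minimizer y gives
   -Q_t^* >= l delta_t - l^2 (M / 2) |x^t - y|^2 for l in [0, 1], so under the
   error bound -Q_t^* is at least a constant times
   min (delta_t, delta_t^(2 - 2 theta)).  Dividing the squared step by this
   quantity, concavity of v^(1/2) and v^theta bounds the step length by a
   constant times the decrease of the potential
   2 delta_t^(1/2) + delta_t^theta / theta.  Hence the trajectory has finite
   length.  The error bound is only local, but by convexity dist(x, Omega) is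
   at most a multiple of F(x) - F* outside of any sublevel set, which yields
   delta_t -> 0. *)
Require Import Defs.
From HB Require Import structures.
From mathcomp Require Import all_boot all_order all_algebra.
From mathcomp Require Import all_classical all_reals all_analysis.
From mathcomp Require Import ring lra.
Import Order.TTheory GRing.Theory Num.Theory.
Local Open Scope classical_set_scope.
Local Open Scope ring_scope.

(** * Euclidean inner product and norm on row vectors *)

Section EuclideanNorm.
Context {R : realType} {n : nat}.
Implicit Types (u v w : 'rV[R]_n) (a : R).

Lemma dotvC u v : dotv u v = dotv v u.
Proof. by apply: eq_bigr => i _; rewrite mulrC. Qed.

Lemma dotvDl u v w : dotv (u + v) w = dotv u w + dotv v w.
Proof. by rewrite -big_split; apply: eq_bigr => i _; rewrite mxE mulrDl. Qed.

Lemma dotvZl a u v : dotv (a *: u) v = a * dotv u v.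
Proof. by rewrite mulr_sumr; apply: eq_bigr => i _; rewrite mxE mulrA. Qed.

Lemma dotvDr u v w : dotv w (u + v) = dotv w u + dotv w v.
Proof. by rewrite dotvC dotvDl !(dotvC w). Qed.

Lemma dotvZr a u v : dotv u (a *: v) = a * dotv u v.
Proof. by rewrite dotvC dotvZl dotvC. Qed.

Lemma dotvBl u v w : dotv (u - v) w = dotv u w - dotv v w.
Proof. by rewrite dotvDl -scaleN1r dotvZl mulN1r. Qed.

Lemma dotvNr u v : dotv u (- v) = - dotv u v.
Proof. by rewrite -scaleN1r dotvZr mulN1r. Qed.

Lemma dotvv_ge0 u : 0 <= dotv u u.
Proof. by apply: sumr_ge0 => i _; rewrite -expr2 sqr_ge0. Qed.

Lemma normv_ge0 u : 0 <= normv u.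
Proof. exact: sqrtr_ge0. Qed.

Lemma sqr_normv u : normv u ^+ 2 = dotv u u.
Proof. by rewrite sqr_sqrtr // dotvv_ge0. Qed.

Lemma normvZ a u : normv (a *: u) = `|a| * normv u.
Proof.
by rewrite /normv dotvZl dotvZr mulrA -expr2 sqrtrM ?sqr_ge0 // sqrtr_sqr.
Qed.

Lemma normvN u : normv (- u) = normv u.
Proof. by rewrite -scaleN1r normvZ normrN1 mul1r. Qed.

Lemma ler_coord_normv u i : `|u ord0 i| <= normv u.
Proof.
rewrite -sqrtr_sqr ler_sqrt ?dotvv_ge0 // /dotv (bigD1 i) //= -expr2 lerDl.
by apply: sumr_ge0 => j _; rewrite -expr2 sqr_ge0.
Qed.

Lemma normv_eq0 u : normv u = 0 -> u = 0.
Proof.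
move=> u0; apply/rowP => i; rewrite mxE; apply/normr0_eq0/le_anti.
by rewrite normr_ge0 -u0 ler_coord_normv.
Qed.

(** Cauchy-Schwarz, from the nonnegative square of [normv v *: u - normv u *: v]. A factor
    [normv u * normv v] is cancelled, hence the separate zero cases. *)
Lemma ler_dotv u v : dotv u v <= normv u * normv v.
Proof.
have [u0|u0] := eqVneq (normv u) 0.
  rewrite u0 mul0r (normv_eq0 _ u0) /dotv big1 // => i _.
  by rewrite mxE mul0r.
have [v0|v0] := eqVneq (normv v) 0.
  rewrite v0 mulr0 (normv_eq0 _ v0) /dotv big1 // => i _.
  by rewrite mxE mulr0.
have uv0 : 0 < normv u * normv v.
  by rewrite mulr_gt0 // lt_neqAle eq_sym normv_ge0 ?u0 ?v0.
have := dotvv_ge0 (normv v *: u - normv u *: v).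
rewrite -scaleNr !(dotvDl, dotvDr, dotvZl, dotvZr) (dotvC v u) -!sqr_normv.
move: (normv u) (normv v) (dotv u v) uv0 => a b c uv0 h.
rewrite -(ler_pM2l uv0); nra.
Qed.

Lemma ler_normvD u v : normv (u + v) <= normv u + normv v.
Proof.
rewrite -(@ler_pXn2r _ 2) ?nnegrE ?addr_ge0 ?normv_ge0 //.
rewrite sqr_normv !(dotvDl, dotvDr) (dotvC v u) -!sqr_normv sqrrD.
have := ler_dotv u v; lra.
Qed.

Lemma normv_le_sum u : normv u <= \sum_i `|u ord0 i|.
Proof.
have s0 : 0 <= \sum_i `|u ord0 i| by apply: sumr_ge0.
rewrite -(@ler_pXn2r _ 2) ?nnegrE ?normv_ge0 // sqr_normv expr2 mulr_suml.
apply: ler_sum => i _; apply: (le_trans (ler_norm _)).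
rewrite normrM ler_wpM2l // (bigD1 i) //= lerDl.
exact: sumr_ge0.
Qed.

End EuclideanNorm.

(** * First-order inequalities for a convex smooth function *)

Section ConvexSmooth.
Context {R : realType} {n : nat}.
Variables (f : 'rV[R]_n -> R) (g : 'rV[R]_n -> 'rV[R]_n) (L : R).
Hypotheses (cvxf : convex_fun f) (smoothf : L_smooth L f g).

(** Convexity bounds the difference quotient along [l *: h] by [f (x + h) - f x]; for small [l] that
    quotient is close to [dotv (g x) h]. *)
Lemma convex_gradient_ineq x h : f x + dotv (g x) h <= f (x + h).
Proof.
apply/ler_addgt0Pr => e e0.
(* The [+ 1] keeps the denominators positive when [h = 0]. *)
have h1 : 0 < normv h + 1 by rewrite ltr_wpDl // normv_ge0.
have [d d0 fd] := smoothf.1 x (e / (normv h + 1)) (divr_gt0 e0 h1).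
have := normv_ge0 h; set N := normv h in h1 fd * => N0.
pose l := Num.min 1 (d / (2 * (N + 1))).
have q0 : 0 < d / (2 * (N + 1)) by rewrite divr_gt0 // mulr_gt0.
have l0 : 0 < l by rewrite lt_min ltr01.
have l1 : l <= 1 by rewrite ge_min lexx.
have ld : l * N < d.
  have : l <= d / (2 * (N + 1)) by rewrite ge_min lexx orbT.
  rewrite ler_pdivlMr ?mulr_gt0 // => ?; nra.
have := fd (l *: h); rewrite normvZ gtr0_norm // -/N dotvZr => /(_ ld).
rewrite ler_norml => /andP[lo _].
have := cvxf (x + h) x l; rewrite ltW //= l1 => /(_ isT).
have -> : l *: (x + h) + (1 - l) *: x = x + l *: h.
  by rewrite scalerDr scalerBl scale1r; apply/rowP=> i; rewrite !mxE; ring.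
move=> up; rewrite -(ler_pM2l l0).
have : e / (N + 1) * (l * N) <= l * e.
  by rewrite mulrAC ler_pdivrMr //; nra.
lra.
Qed.

(* Convexity at [x + h] replaces the mean value theorem, at the price of the
   constant [L] instead of [L / 2]. *)
Lemma convex_descent x h : f (x + h) <= f x + dotv (g x) h + L * normv h ^+ 2.
Proof.
have := convex_gradient_ineq (x + h) (- h); rewrite addrK dotvNr.
have := ler_dotv (g (x + h) - g x) h; rewrite dotvBl.
have := smoothf.2 (x + h) x; rewrite (addrC x) addrK.
have := normv_ge0 h; move: (normv _) (normv _) => N N'; nra.
Qed.

End ConvexSmooth.

(** * Infimum distance to a set *)

Section DistanceToSet.
Context {R : realType} {n : nat}.
Implicit Types (x y z : 'rV[R]_n) (A : set 'rV[R]_n) (r : R).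

(** Points slightly beyond the infimum replace projections in later arguments. Nonemptiness matters,
    since [inf] of the empty set is 0 by default. *)
Lemma distv_lt x A r : A !=set0 -> distv x A < r ->
  exists2 y, A y & normv (x - y) < r.
Proof.
move=> [y0 Ay0] /inf_lt[|_ [y Ay <-] h]; last by exists y.
by exists (normv (x - y0)); exists y0.
Qed.

Lemma distv_le x y A : A y -> distv x A <= normv (x - y).
Proof.
move=> Ay; apply: ge_inf; last by exists y.
by exists 0 => _ [z _ <-]; exact: normv_ge0.
Qed.

Lemma distv_triangle x z A : A !=set0 ->
  distv x A <= normv (x - z) + distv z A.
Proof.
move=> A0; apply/ler_addgt0Pr => e e0.
have [|y Ay zy] := distv_lt z A (distv z A + e) A0; first by rewrite ltrDl.
have := distv_le x _ _ Ay; have := ler_normvD (x - z) (z - y).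
rewrite addrA subrK; lra.
Qed.

End DistanceToSet.

(** * Decreasing sequences, concave powers and the potential *)

Section RealSequences.
Context {R : realType}.
Implicit Types (u : nat -> R) (a b c k s w rho : R).

(** If the level [eps] were never reached, a decrease of at least [k] per step would make [u]
    negative in finite time. *)
Lemma decrease_eventually_le u eps k : 0 < k ->
  (forall t, 0 <= u t) -> (forall t, u t.+1 <= u t) ->
  (forall t, eps < u t -> u t.+1 <= u t - k) ->
  exists T, forall t, (T <= t)%N -> u t <= eps.
Proof.
move=> k0 u0 ud uk.
have [[T uT]|nex] := pselect (exists T, u T <= eps).
  exists T => t Tt; apply: le_trans uT.
  by have /nonincreasing_seqP/(_ T t Tt) := ud.
have gt t : eps < u t by rewrite ltNge; apply/negP => h; apply: nex; exists t.
have lin t : u t <= u 0%N - t%:R * k.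
  elim: t => [|t IH]; first by rewrite mul0r subr0.
  by have := uk t (gt t); rewrite -natr1; lra.
have := archi_boundP (divr_ge0 (u0 0%N) (ltW k0)).
set N := Num.bound _; rewrite ltr_pdivrMr // => h.
have := lin N; have := u0 N; lra.
Qed.

(** Young's inequality for the conjugate exponents [(1 - rho)^-1] and [rho^-1]; the endpoint
    [rho = 1] is treated directly. *)
Lemma weighted_amgm a b rho : 0 <= a -> 0 <= b -> 0 < rho <= 1 ->
  a `^ (1 - rho) * b `^ rho <= (1 - rho) * a + rho * b.
Proof.
move=> a0 b0 /andP[rho0]; rewrite le_eqVlt => /orP[/eqP ->|rho1].
  by rewrite subrr powRr0 powRr1 // !mul1r mul0r add0r.
have r1 : 0 < 1 - rho by rewrite subr_gt0.
have := @conjugate_powR R (a `^ (1 - rho)) (b `^ rho) (1 - rho)^-1 rho^-1.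
rewrite !powR_ge0 !invr_gt0 r1 rho0 !invrK subrK -!powRrM.
rewrite !divff ?gt_eqF // !powRr1 // => /(_ isT isT isT isT erefl).
lra.
Qed.

Lemma powR_concave_slope a b rho : 0 < a -> 0 <= b -> 0 < rho <= 1 ->
  rho * (a - b) <= a `^ (1 - rho) * (a `^ rho - b `^ rho).
Proof.
move=> a0 b0 rho01; have := weighted_amgm a b rho (ltW a0) b0 rho01.
have : a `^ (1 - rho) * a `^ rho = a.
  by rewrite -powRD ?subrK ?powRr1 ?(ltW a0) // oner_eq0.
lra.
Qed.

(* Here [s] is a step length, [a] and [b] consecutive objective gaps, and [w]
   the model decrease linking them. *)
Lemma step_le_powR_decrease a b c k m s w rho :
  0 < a -> 0 <= b -> 0 < c -> 0 < k -> 0 < m -> 0 <= s -> 0 < rho <= 1 ->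
  k * (a `^ (1 - rho)) ^+ 2 <= w -> c * w <= a - b -> m * s ^+ 2 <= 8 * w ->
  s <= Num.sqrt (8 / (m * k)) / c * ((a `^ rho - b `^ rho) / rho).
Proof.
move=> a0 b0 c0 k0 m0 s0 rho01 kw cw mw.
have := powR_concave_slope a b rho a0 b0 rho01.
have r0 : 0 < a `^ (1 - rho) by exact: powR_gt0.
move: (a `^ (1 - rho)) r0 kw => r r0 kw.
move: (a `^ rho - b `^ rho) => d slope.
case/andP: rho01 => rho0 _.
have w0 : 0 <= w by apply: le_trans kw; rewrite mulr_ge0 ?sqr_ge0 ?ltW.
have mk0 : 0 < m * k by exact: mulr_gt0.
set K := Num.sqrt _; have K0 : 0 <= K by exact: sqrtr_ge0.
(* The product of [m * s ^+ 2 <= 8 * w] and [k * r ^+ 2 <= w], after a square root. *)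
have sr : s * r <= K * w.
  rewrite -(@ler_pXn2r _ 2) ?nnegrE ?mulr_ge0 ?(ltW r0) //.
  rewrite [leRHS]exprMn sqr_sqrtr ?divr_ge0 ?(ltW mk0) //.
  rewrite [leRHS]mulrAC ler_pdivlMr //.
  have -> : (s * r) ^+ 2 * (m * k) = (m * s ^+ 2) * (k * r ^+ 2) by ring.
  have -> : 8 * w ^+ 2 = (8 * w) * w by ring.
  by apply: ler_pM => //; rewrite mulr_ge0 ?sqr_ge0 ?(ltW m0) ?(ltW k0).
have wd : w * (c * rho) <= r * d.
  apply: le_trans slope.
  by have := ler_wpM2l (ltW rho0) cw; lra.
rewrite -(ler_pM2r r0); apply: (le_trans sr).
have -> : K / c * (d / rho) * r = K * (r * d / (c * rho)).
  by field; rewrite !gt_eqF.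
by rewrite ler_wpM2l // ler_pdivlMr // mulr_gt0.
Qed.

(** Each branch of the minimum bounds [s] by the decrease of one power. Both decreases are
    nonnegative, so their sum covers either branch, and [k] lies below both branch constants. *)
Lemma step_le_potential a b c m M zeta theta s w :
  let k := 2^-1 * Num.min 1 (zeta ^+ 2 / (4 * M)) in
  let W v := Num.sqrt (8 / (m * k)) / c
             * (v `^ 2^-1 / 2^-1 + v `^ theta / theta) in
  0 <= a -> 0 <= b -> 0 < c -> 0 < m -> 0 < M -> 0 < zeta ->
  0 < theta <= 1 -> 0 <= s -> 0 <= w ->
  (0 < a -> 2^-1 * a * Num.min 1 (a / (4 * M * (a `^ theta / zeta) ^+ 2)) <= w) ->
  c * w <= a - b -> m * s ^+ 2 <= 8 * w -> s <= W a - W b.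
Proof.
move=> k W a0 b0 c0 m0 M0 zeta0 theta01 s0 w0 gap cw mw.
have ba : b <= a by rewrite -subr_ge0 (le_trans _ cw) // mulr_ge0 // ltW.
(* A zero gap forces [b = 0], then [w = 0], then [s = 0]. *)
have [ap|an] := ltP 0 a; last first.
  have a00 : a = 0 by apply/le_anti/andP.
  have b00 : b = 0 by apply/le_anti; rewrite b0 -a00 ba.
  rewrite a00 b00 subrr -(@ler_pXn2r _ 2) ?nnegrE // expr0n /=.
  rewrite -(pmulr_rle0 _ m0); apply: (le_trans mw); rewrite pmulr_rle0 //.
  by rewrite -(pmulr_rle0 _ c0); apply: (le_trans cw); rewrite a00 b00 subrr.
have [theta0 _] := andP theta01.
have M4 : 0 < 4 * M by rewrite mulr_gt0.
have z2 : 0 < zeta ^+ 2 by rewrite exprn_gt0.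
have k0 : 0 < k by rewrite mulr_gt0 ?invr_gt0 // lt_min ltr01 divr_gt0.
have half01 : 0 < (2^-1 : R) <= 1 by lra.
have mono rho : 0 < rho -> 0 <= (a `^ rho - b `^ rho) / rho.
  move=> rho0; rewrite divr_ge0 ?(ltW rho0) // subr_ge0.
  by rewrite ge0_ler_powR ?nnegrE ?(ltW rho0).
set C := Num.sqrt (8 / (m * k)) / c.
have C0 : 0 <= C by rewrite divr_ge0 ?sqrtr_ge0 // ltW.
have -> : W a - W b = C * ((a `^ 2^-1 - b `^ 2^-1) / 2^-1)
                      + C * ((a `^ theta - b `^ theta) / theta).
  by rewrite /W -/C; ring.
have one_power rho : rho = 2^-1 \/ rho = theta ->
    k * (a `^ (1 - rho)) ^+ 2 <= w ->
    s <= C * ((a `^ 2^-1 - b `^ 2^-1) / 2^-1)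
         + C * ((a `^ theta - b `^ theta) / theta).
  move=> rhoE kw.
  have rho01 : 0 < rho <= 1 by case: rhoE => ->.
  have := step_le_powR_decrease a b c k m s w rho ap b0 c0 k0 m0 s0 rho01 kw cw mw.
  move/le_trans; apply; rewrite -/C.
  by case: rhoE => ->; rewrite ?lerDl ?lerDr mulr_ge0 // mono // invr_gt0.
move: (gap ap); rewrite minEle; case: ifP => _ gapw.
  apply: (one_power 2^-1); first by left.
  have -> : 1 - 2^-1 = 2^-1 :> R by lra.
  rewrite powR12_sqrt // sqr_sqrtr //; apply: le_trans gapw.
  rewrite mulr1 ler_pM2r // /k -[leRHS]mulr1 ler_pM2l ?invr_gt0 //.
  by rewrite ge_min lexx.
apply: (one_power theta); first by right.
apply: le_trans gapw.
have pa : 0 < a `^ theta by exact: powR_gt0.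
have -> : a `^ (1 - theta) = a / a `^ theta.
  by rewrite powRB ?powRr1 // (gt_eqF ap) implybT.
have -> : 2^-1 * a * (a / (4 * M * (a `^ theta / zeta) ^+ 2)) =
    2^-1 * (zeta ^+ 2 / (4 * M)) * (a / a `^ theta) ^+ 2.
  by field; rewrite !gt_eqF.
rewrite ler_wpM2r ?sqr_ge0 // ler_pM2l ?invr_gt0 //.
by rewrite ge_min lexx orbT.
Qed.

End RealSequences.

(** * Convergence of trajectories of finite length *)

Section FiniteLength.
Context {R : realType} {n : nat}.
Implicit Types (x : nat -> 'rV[R]_n) (W : nat -> R).

(** The step lengths are dominated by a telescoping sum. The limit is built coordinate by coordinate
    from monotone convergence. *)
Lemma finite_length_cvg x W : (forall t, 0 <= W t) ->
  (forall t, normv (x t.+1 - x t) <= W t - W t.+1) ->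
  exists xs, forall eps, 0 < eps ->
    exists T : nat, forall t, (T <= t)%N -> normv (x t - xs) < eps.
Proof.
move=> W0 xW.
have coord t i : `|x t.+1 ord0 i - x t ord0 i| <= W t - W t.+1.
  by have := le_trans (ler_coord_normv _ i) (xW t); rewrite !mxE.
have Wcvg : W @ \oo --> inf (range W).
  apply: nonincreasing_cvgn; last by exists 0 => _ [t _ <-].
  by apply/nonincreasing_seqP => t; have := le_trans (normv_ge0 _) (xW t); lra.
(* each coordinate of [x], shifted by [W], is nonincreasing *)
pose u i t := x t ord0 i + W t.
have ucvg i : u i @ \oo --> inf (range (u i)).
  apply: nonincreasing_cvgn.
    apply/nonincreasing_seqP => t; have := coord t i.
    by rewrite ler_norml /u; lra.
  exists (x 0%N ord0 i - W 0%N) => _ [t _ <-]; rewrite /u.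
  (* The opposite shift, by [- W], is nondecreasing and so bounds [u i] from below. *)
  have : x 0%N ord0 i - W 0%N <= x t ord0 i - W t.
    elim: t => // t /le_trans; apply; have := coord t i.
    by rewrite ler_norml; lra.
  have := W0 t; lra.
exists (\row_i (inf (range (u i)) - inf (range W))) => eps eps0.
(* With tolerance [eps / (n + 1)] per coordinate, the [n] errors sum to strictly less than [eps],
   even for [n = 0]. *)
have n0 : 0 < (n%:R + 1 : R) by rewrite ltr_wpDl.
have xcvg i : \forall t \near \oo,
    `|(x t - \row_i (inf (range (u i)) - inf (range W))) ord0 i|
    <= eps / (n%:R + 1).
  have xc : u i t - W t @[t --> \oo] --> inf (range (u i)) - inf (range W).
    exact: cvgB (ucvg i) Wcvg.
  near=> t; rewrite !mxE.
  have -> : x t ord0 i = u i t - W t by rewrite /u addrK.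
  rewrite distrC ltW //; near: t.
  exact: (cvgrPdist_lt _ _).1 xc _ (divr_gt0 eps0 n0).
have [T _ HT] := filter_forall _ xcvg.
exists T => t /HT /= h.
apply: (le_lt_trans (normv_le_sum _)).
apply: (@le_lt_trans _ _ (\sum_(i < n) (eps / (n%:R + 1)))).
  by apply: ler_sum => i _; exact: h.
rewrite sumr_const card_ord -[ltLHS]mulr_natr mulrAC ltr_pdivrMr //.
by rewrite ltr_pM2l // ltrDl.
Unshelve. all: by end_near. Qed.

End FiniteLength.

(** * The composite objective and its finite values *)

Section Composite.
Context {R : realType} {n : nat}.
Variables (f : 'rV[R]_n -> R) (g : 'rV[R]_n -> 'rV[R]_n) (L : R).
Variable (Psi : 'rV[R]_n -> \bar R).
Hypotheses (cvxf : convex_fun f) (smoothf : L_smooth L f g).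
Hypotheses (cvxPsi : convex_efun Psi) (properPsi : proper_efun Psi).
Hypothesis argmin_neq0 : argminset (Fobj f Psi) !=set0.
Implicit Types (x p y z : 'rV[R]_n) (l : R).

Local Notation F := (Fobj f Psi).
Local Notation Fr z := (fine (Fobj f Psi z)).
Local Notation psi z := (fine (Psi z)).
Local Notation dom z := (Psi z \is a fin_num).

Lemma lty_fin_num_Psi z : (Psi z < +oo)%E -> dom z.
Proof. by move=> zoo; rewrite fin_numE properPsi.1 /= -ltey. Qed.

Lemma Fobj_fin z : dom z -> F z = (f z + psi z)%:E.
Proof. by move=> dz; rewrite /Fobj -{1}(fineK dz). Qed.

Lemma fine_Fobj z : dom z -> Fr z = f z + psi z.
Proof. by move=> dz; rewrite Fobj_fin. Qed.

Lemma Fobj_lty_fin z : (F z < +oo)%E -> dom z.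
Proof.
move=> h; apply: lty_fin_num_Psi; move: h; rewrite /Fobj.
by case: (Psi z) => // r _; rewrite ltry.
Qed.

Lemma convex_efun_fine y z l : 0 <= l <= 1 -> dom y -> dom z ->
  dom (l *: y + (1 - l) *: z) /\
  psi (l *: y + (1 - l) *: z) <= l * psi y + (1 - l) * psi z.
Proof.
move=> l01 dy dz; have := cvxPsi y z l l01.
rewrite -(fineK dy) -(fineK dz) -!EFinM -EFinD => h.
have d : dom (l *: y + (1 - l) *: z).
  by apply: lty_fin_num_Psi; apply: le_lt_trans h (ltry _).
by split=> //; rewrite -lee_fin (fineK d).
Qed.

Lemma convex_efun_segment x p l : 0 <= l <= 1 -> dom x -> dom (x + p) ->
  dom (x + l *: p) /\ psi (x + l *: p) <= psi x + l * (psi (x + p) - psi x).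
Proof.
move=> l01 dx dp; have [] := convex_efun_fine _ _ _ l01 dp dx.
have -> : l *: (x + p) + (1 - l) *: x = x + l *: p.
  by apply/rowP=> i; rewrite !mxE; ring.
by move=> d h; split=> //; lra.
Qed.

Lemma argmin_fin y : argminset F y -> dom y.
Proof.
move=> Fy; apply: Fobj_lty_fin; have [z zoo] := properPsi.2.
apply: (le_lt_trans (Fy z)).
by rewrite (Fobj_fin _ (lty_fin_num_Psi _ zoo)) ltry.
Qed.

Lemma minvalE y : argminset F y -> minval F = Fr y.
Proof.
move=> Fy; congr fine; apply/le_anti/andP; split.
  by apply: ereal_inf_lbound; exists y.
by apply: le_ereal_inf_tmp => _ [z _ <-]; exact: Fy.
Qed.

Lemma minval_le z : dom z -> minval F <= Fr z.
Proof.
move=> dz; have [y Fy] := argmin_neq0; have := Fy z.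
by rewrite (minvalE _ Fy) (Fobj_fin _ dz) (Fobj_fin _ (argmin_fin _ Fy)) lee_fin.
Qed.

Lemma minval_argmin z : dom z -> Fr z <= minval F -> argminset F z.
Proof.
move=> dz; have [y Fy] := argmin_neq0; rewrite (minvalE _ Fy) => zy w.
apply: le_trans (Fy w); move: zy.
by rewrite (Fobj_fin _ dz) (Fobj_fin _ (argmin_fin _ Fy)) lee_fin.
Qed.

(** Real form of [Qmodel], faithful only where [Psi] is finite at [x] and at [x + p], because [fine]
    sends infinities to 0. *)
Definition qreal (H : 'M[R]_n) x p : R :=
  dotv (g x) p + 2^-1 * dotv p (p *m H) + psi (x + p) - psi x.

Lemma Qmodel_fin H x p : dom x -> dom (x + p) ->
  Qmodel g Psi H x p = (qreal H x p)%:E.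
Proof. by move=> dx dp; rewrite /Qmodel -{1}(fineK dx) -{1}(fineK dp). Qed.

Lemma Qmodel_lty_fin H x p : dom x ->
  (Qmodel g Psi H x p < +oo)%E -> dom (x + p).
Proof.
move=> dx; rewrite /Qmodel -(fineK dx) => h; apply: lty_fin_num_Psi.
by move: h; case: (Psi (x + p)) => // r _; rewrite ltry.
Qed.

(** * The quadratic model and one inexact step *)

Section Model.
Variables (H : 'M[R]_n) (m M : R) (x : 'rV[R]_n).
Hypotheses (L0 : 0 < L) (m0 : 0 < m) (dx : dom x).
Hypothesis Hbnd : forall v, m * dotv v v <= dotv v (v *m H) <= M * dotv v v.

Local Notation q p := (qreal H x p).
Local Notation Qs := (fine (Qopt g Psi H x)).

(** The smoothness error [L * l ^+ 2 * dotv p p] is absorbed by [l] times the quadratic term of the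
    model as soon as [2 * L * l <= m]. *)
Lemma model_descent p l : dom (x + p) -> 0 <= l <= 1 -> 2 * L * l <= m ->
  dom (x + l *: p) /\ Fr (x + l *: p) <= Fr x + l * q p.
Proof.
move=> dp l01 Ll; have [dl psil] := convex_efun_segment x p l l01 dx dp.
split=> //; rewrite !fine_Fobj // /qreal.
have := convex_descent f g L cvxf smoothf x (l *: p).
rewrite sqr_normv dotvZl !dotvZr.
have /andP[+ _] := Hbnd p; have := dotvv_ge0 p.
move: psil; case/andP: l01 => l0 l1.
move: (dotv p p) (dotv p (p *m H)) (dotv (g x) p) => N A B psil N0 mN fl.
suff : L * (l * (l * N)) <= l * (2^-1 * A) by lra.
have : 2 * L * l * N <= m * N by rewrite ler_wpM2r.
nra.
Qed.

(** By [model_descent] at a fixed admissible [l], the lower bound [minval F] on the objective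
    carries over to the model; the step 0 bounds the infimum above. *)
Lemma Qopt_fin_num : Qopt g Psi H x \is a fin_num.
Proof.
pose l := Num.min 1 (m / (2 * L)).
have l0 : 0 < l by rewrite lt_min ltr01 divr_gt0 ?mulr_gt0.
have l1 : l <= 1 by rewrite ge_min lexx.
have Ll : 2 * L * l <= m.
  by rewrite mulrC -ler_pdivlMr ?mulr_gt0 // ge_min lexx orbT.
have lb : ((l^-1 * (minval F - Fr x))%:E <= Qopt g Psi H x)%E.
  apply: le_ereal_inf_tmp => _ [p _ <-].
  have [/(Qmodel_lty_fin _ _ _ dx) dp|] := ltP (Qmodel g Psi H x p) +oo%E; last first.
    by rewrite leye_eq => /eqP ->; rewrite leey.
  rewrite Qmodel_fin // lee_fin -ler_pdivlMl ?invr_gt0 // invrK.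
  have [|dl Fl] := model_descent p l dp _ Ll; first by rewrite ltW.
  have := minval_le _ dl; lra.
rewrite fin_numE; apply/andP; split.
  by rewrite -ltNye (lt_le_trans (ltNyr _) lb).
rewrite -ltey; apply: (@le_lt_trans _ _ (q 0)%:E); last exact: ltry.
apply: ereal_inf_lbound; exists 0 => //.
by rewrite Qmodel_fin // addr0.
Qed.

Lemma Qopt_le p : dom (x + p) -> Qs <= q p.
Proof.
move=> dp; rewrite -lee_fin fineK ?Qopt_fin_num // -Qmodel_fin //.
by apply: ereal_inf_lbound; exists p.
Qed.

(* Compares [p] with the half step [p / 2] instead of with the exact minimizer
   of the model, which need not be known to exist. *)
Lemma model_step_bound p : dom (x + p) ->
  m * normv p ^+ 2 <= 4 * q p - 8 * Qs.
Proof.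
move=> dp; have h01 : 0 <= (2^-1 : R) <= 1 by lra.
have [dh psih] := convex_efun_segment x p _ h01 dx dp.
have := Qopt_le _ dh; rewrite /qreal -scalemxAl dotvZl !dotvZr sqr_normv.
have /andP[+ _] := Hbnd p; move: (dotv p p) (dotv p (p *m H)) (dotv (g x) p) => *; lra.
Qed.

Lemma Qopt_gap y l : argminset F y -> 0 <= l <= 1 ->
  l * (Fr x - minval F) - l ^+ 2 * (2^-1 * M * normv (x - y) ^+ 2) <= - Qs.
Proof.
move=> Fy l01; have dy := argmin_fin _ Fy.
have xy : x + (y - x) = y by rewrite addrC subrK.
have [|dl psil] := convex_efun_segment x (y - x) _ l01 dx; first by rewrite xy.
have := Qopt_le _ dl; rewrite /qreal -scalemxAl dotvZl !dotvZr.
have := convex_gradient_ineq f g L cvxf smoothf x (y - x).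
rewrite -(normvN (x - y)) opprB sqr_normv (minvalE _ Fy) !fine_Fobj //.
have /andP[_] := Hbnd (y - x); rewrite {}xy in psil *.
move: (dotv (y - x) (y - x)) (dotv (y - x) ((y - x) *m H)).
move: (dotv (g x) (y - x)) => B N A.
case/andP: l01 => l0 l1.
move=> h1 h2 h3; have := ler_wpM2l l0 h2.
have := ler_wpM2l (sqr_ge0 l) h1; rewrite !expr2; lra.
Qed.

Lemma Qopt_le0 : Qs <= 0.
Proof.
have [y Fy] := argmin_neq0; have := Qopt_gap y 0 Fy.
by rewrite lexx ler01 mul0r expr0n mul0r subrr oppr_ge0; apply.
Qed.

Lemma Qopt_gap_dist B : 0 < M -> 0 < B -> distv x (argminset F) <= B ->
  2^-1 * (Fr x - minval F) * Num.min 1 ((Fr x - minval F) / (4 * M * B ^+ 2))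
  <= - Qs.
Proof.
move=> M0 B0 xB; have d0 : 0 <= Fr x - minval F by rewrite subr_ge0 minval_le.
have [|y Fy xy] := distv_lt x _ (2 * B) argmin_neq0; first lra.
(* Since [normv (x - y) < 2 * B], this [l] makes the quadratic loss in [Qopt_gap] at most half of
   the linear gain. *)
set l := Num.min _ _.
have q0 : 0 < 4 * M * B ^+ 2 by rewrite !mulr_gt0 // exprn_gt0.
have l0 : 0 <= l by rewrite le_min ler01 divr_ge0 // ltW.
have l1 : l <= 1 by rewrite ge_min lexx.
have lB : l * (4 * M * B ^+ 2) <= Fr x - minval F.
  by rewrite -ler_pdivlMr // ge_min lexx orbT.
have := Qopt_gap y l Fy; rewrite l0 l1 => /(_ isT); apply: le_trans.
have N4 : normv (x - y) ^+ 2 <= 4 * B ^+ 2.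
  by have := normv_ge0 (x - y); rewrite !expr2; nra.
have := ler_wpM2l l0 lB; have := ler_wpM2l (mulr_ge0 (sqr_ge0 l) (ltW M0)) N4.
rewrite (expr2 l); lra.
Qed.

(** Inexactness makes [q p] at most [(1 - eta) * Qs], and the Armijo test converts this into
    decrease of [F] once [alpha] is bounded below. *)
Lemma inexact_armijo_step p (gam beta eta alpha : R) :
  0 < gam < 1 -> 0 < beta < 1 -> 0 <= eta < 1 ->
  (Qmodel g Psi H x p - Qopt g Psi H x <= - (eta%:E * Qopt g Psi H x))%E ->
  (exists k : nat, alpha = beta ^+ k /\
     armijo F gam x p (Qmodel g Psi H x p) (beta ^+ k) /\
     (forall j : nat, (j < k)%N ->
        ~ armijo F gam x p (Qmodel g Psi H x p) (beta ^+ j))) ->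
  [/\ dom (x + alpha *: p), m * normv (alpha *: p) ^+ 2 <= 8 * - Qs &
     gam * (1 - eta) * Num.min 1 (beta * (m / (2 * L))) * - Qs
       <= Fr x - Fr (x + alpha *: p)].
Proof.
move=> /andP[gam0 gam1] /andP[beta0 beta1] /andP[eta0 eta1].
rewrite -{1 2}(fineK Qopt_fin_num) leeBlDr // -EFinM -EFinN -EFinD => Qp.
have dp : dom (x + p).
  by apply: (Qmodel_lty_fin H) => //; apply: le_lt_trans Qp (ltry _).
move: Qp; rewrite Qmodel_fin // lee_fin => Qp [k [-> [arm back]]].
have Qs0 := Qopt_le0; have q0 : q p <= 0 by nra.
have bk1 j : beta ^+ j <= 1 by rewrite exprn_ile1 // ltW.
have bk0 j : 0 < beta ^+ j by rewrite exprn_gt0.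
move: arm; rewrite /armijo (Fobj_fin x) // -EFinM -EFinD => arm.
have dk : dom (x + beta ^+ k *: p).
  by apply: Fobj_lty_fin; apply: le_lt_trans arm (ltry _).
move: arm; rewrite -fine_Fobj // (Fobj_fin _ dk) lee_fin -fine_Fobj // => arm.
split=> //.
  rewrite normvZ exprMn ger0_norm ?(ltW (bk0 _)) //.
  have := model_step_bound p dp.
  have : (beta ^+ k) ^+ 2 <= 1 by rewrite exprn_ile1 ?bk1 ?(ltW (bk0 k)).
  have := mulr_ge0 (ltW m0) (sqr_ge0 (normv p)); nra.
(* For a positive exponent the preceding trial was rejected, whereas [model_descent] would have
   accepted it had it been below [m / (2 * L)]. *)
have kmin : Num.min 1 (beta * (m / (2 * L))) <= beta ^+ k.
  case: k back {arm dk} => [|k] back; first by rewrite expr0 ge_min lexx.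
  rewrite ge_min exprS ler_pM2l //; apply/orP; right.
  rewrite leNgt; apply/negP; rewrite ltr_pdivlMr ?mulr_gt0 // => Lk.
  apply: (back k) => //; rewrite /armijo (Fobj_fin x) // -EFinM -EFinD.
  have [||dk Fk] := model_descent p (beta ^+ k) dp; first by rewrite bk1 ltW.
    by rewrite mulrC ltW.
  rewrite (Fobj_fin _ dk) lee_fin -!fine_Fobj //; apply: (le_trans Fk).
  have := mulr_le0_ge0 q0 (ltW (bk0 k)); nra.
have e1 : 0 < 1 - eta by rewrite subr_gt0.
apply: (@le_trans _ _ (gam * (1 - eta) * beta ^+ k * - Qs)).
  by rewrite ler_wpM2r ?oppr_ge0 // ler_wpM2l // mulr_ge0 ?(ltW gam0) ?(ltW e1).
have := ler_wpM2l (mulr_ge0 (ltW gam0) (ltW (bk0 k))) Qp; lra.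
Qed.

End Model.

(** * Extension of the local error bound *)

Section ErrorBound.
Variables (xi zeta theta : R).
Hypotheses (zeta0 : 0 < zeta) (theta0 : 0 < theta).
Hypothesis eb : forall y, (F y <= (minval F + xi)%:E)%E ->
  zeta * distv y (argminset F) <= (Fr y - minval F) `^ theta.

(* Convexity along the segment to a nearby minimizer carries the bound from the
   sublevel set [F - F* <= eps] to the points outside of it. *)
Lemma error_bound_outside x eps : dom x -> 0 < eps <= xi ->
  eps < Fr x - minval F ->
  zeta * eps * distv x (argminset F) <= eps `^ theta * (Fr x - minval F).
Proof.
move=> dx /andP[eps0 epsxi] xeps.
have d0 := lt_trans eps0 xeps; set d := Fr x - minval F in xeps d0 *.
(* At this position on the segment convexity bounds the gap by [l * d = eps], so the local error
   bound applies at [z]. *)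
pose l := eps / d.
have l0 : 0 < l by rewrite divr_gt0.
have l1 : l <= 1 by rewrite ler_pdivrMr // mul1r ltW.
have ld : l * d = eps by rewrite /l divfK // gt_eqF.
suff h : zeta * (l * distv x (argminset F)) <= eps `^ theta.
  have -> : zeta * eps * distv x (argminset F) =
      zeta * (l * distv x (argminset F)) * d by rewrite -ld; ring.
  by rewrite ler_wpM2r // ltW.
apply/ler_addgt0Pr => e e0.
have [|y Fy xy] := distv_lt x _ (distv x (argminset F) + e / zeta) argmin_neq0.
  by rewrite ltrDl divr_gt0.
have l01 : 0 <= l <= 1 by rewrite ltW.
have dy := argmin_fin _ Fy.
have [dz psiz] := convex_efun_fine x y l l01 dx dy.
have fz := cvxf x y l l01.
set z := l *: x + (1 - l) *: y in dz psiz fz.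
have Fz : Fr z - minval F <= eps.
  by rewrite -ld /d (minvalE _ Fy) !fine_Fobj //; lra.
have := eb z; rewrite (Fobj_fin _ dz) lee_fin -fine_Fobj // => /(_ ltac:(lra)) ebz.
have ez : zeta * distv z (argminset F) <= eps `^ theta.
  apply: le_trans ebz _; rewrite ge0_ler_powR ?nnegrE ?(ltW theta0) ?(ltW eps0) //.
  by rewrite subr_ge0 minval_le.
(* Up to the slack [e / zeta], moving from [x] to [z] costs [(1 - l)] times the distance of [x],
   which leaves [l] times it below the distance of [z]. *)
have := distv_triangle x z _ argmin_neq0.
have -> : x - z = (1 - l) *: (x - y).
  by apply/rowP=> i; rewrite !mxE; ring.
rewrite normvZ ger0_norm ?subr_ge0 // => tri.
move: xy; rewrite -ltrBlDl ltr_pdivlMr // => xy.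
have := ler_wpM2l (ltW zeta0) tri.
have : (1 - l) * ((normv (x - y) - distv x (argminset F)) * zeta) <= e.
  by rewrite -[leRHS]mul1r; nra.
lra.
Qed.

End ErrorBound.
(* The gradient inequality makes [f] lower semicontinuous. *)
Lemma limit_in_argmin (x : nat -> 'rV[R]_n) xs : lsc_efun Psi ->
  (forall t, dom (x t)) ->
  (forall eps, 0 < eps -> exists T : nat, forall t, (T <= t)%N ->
     normv (x t - xs) < eps) ->
  (forall eps, 0 < eps -> exists T : nat, forall t, (T <= t)%N ->
     Fr (x t) - minval F <= eps) ->
  argminset F xs.
Proof.
move=> lscPsi dx xxs Fx.
(* Real thresholds [a] also cover the case where [Psi xs] is infinite. *)
have low a : (a%:E < Psi xs)%E -> f xs + a <= minval F.
  move=> aPsi; apply/ler_addgt0Pr => e e0.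
  have [d d0 nearPsi] := lscPsi _ _ aPsi.
  have g1 : 0 < normv (g xs) + 1 by rewrite ltr_wpDl ?normv_ge0.
  (* Within this radius the linear term at [xs] costs at most [e / 2]; the gap of [F] takes the
     other half. *)
  pose r := Num.min d (e / 2 / (normv (g xs) + 1)).
  have r0 : 0 < r by rewrite lt_min d0 !divr_gt0.
  have [T1 /(_ (maxn T1 _)) xT] := xxs _ r0.
  have [T2 /(_ (maxn _ T2)) FT] := Fx (e / 2) ltac:(by rewrite divr_gt0).
  move: (xT T2 (leq_maxl _ _)) (FT T1 (leq_maxr _ _)) => {xT FT}.
  set t := maxn _ _; rewrite lt_min => /andP[xd xe] Fe.
  have := nearPsi _ xd; rewrite -(fineK (dx t)) lte_fin => aP.
  move: Fe; rewrite fine_Fobj // => Fe.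
  have := convex_gradient_ineq f g L cvxf smoothf xs (x t - xs).
  rewrite (addrC xs) subrK.
  have := ler_dotv (- g xs) (x t - xs).
  rewrite -scaleN1r dotvZl mulN1r scaleN1r normvN.
  move: xe; rewrite ltr_pdivlMr //.
  have := normv_ge0 (x t - xs); lra.
have dxs : dom xs.
  apply: lty_fin_num_Psi; rewrite ltey; apply/eqP => Poo.
  have := low (minval F - f xs + 1); rewrite Poo => /(_ (ltry _)); lra.
apply: minval_argmin => //; rewrite fine_Fobj //.
apply/ler_addgt0Pr => e e0; have := low (psi xs - e).
by rewrite -[ltRHS](fineK dxs) lte_fin gtrBl => /(_ e0); lra.
Qed.

End Composite.

(** * Convergence of the iterates to a minimizer *)

Theorem theorem3 (R : realType) (n : nat)
  (f : 'rV[R]_n -> R) (g : 'rV[R]_n -> 'rV[R]_n) (Psi : 'rV[R]_n -> \bar R)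
  (L m M eta xi zeta theta gam beta : R)
  (x p : nat -> 'rV[R]_n) (H : nat -> 'M[R]_n) (alpha : nat -> R) :
  (* problem assumptions *)
  argminset (Fobj f Psi) !=set0 ->
  0 < L -> convex_fun f -> L_smooth L f g ->
  convex_efun Psi -> proper_efun Psi -> lsc_efun Psi ->
  (* initial point in dom Psi (needed for Q_0 to be defined) *)
  (Psi (x 0%N) < +oo)%E ->
  (* ISQA parameters *)
  0 < gam < 1 -> 0 < beta < 1 ->
  (* H_t self-adjoint with M I >= H_t >= m I *)
  0 < m -> m <= M ->
  (forall t, (H t)^T = H t) ->
  (forall t v, m * dotv v v <= dotv v (v *m H t) <= M * dotv v v) ->
  (* inexactness of the subproblem solutions *)
  0 <= eta < 1 ->
  (forall t, (Qmodel g Psi (H t) (x t) (p t) - Qopt g Psi (H t) (x t)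
             <= - (eta%:E * Qopt g Psi (H t) (x t)))%E) ->
  (* backtracking: alpha_t = beta^k largest in {1,beta,beta^2,...} passing Armijo *)
  (forall t, exists k : nat,
     alpha t = beta ^+ k /\
     armijo (Fobj f Psi) gam (x t) (p t) (Qmodel g Psi (H t) (x t) (p t)) (beta ^+ k) /\
     (forall j : nat, (j < k)%N ->
        ~ armijo (Fobj f Psi) gam (x t) (p t) (Qmodel g Psi (H t) (x t) (p t)) (beta ^+ j))) ->
  (forall t, x t.+1 = x t + alpha t *: p t) ->
  (* error bound / sharpness condition *)
  0 < xi -> 0 < zeta -> 4^-1 < theta <= 1 ->
  (forall y, (Fobj f Psi y <= (minval (Fobj f Psi) + xi)%:E)%E ->
     zeta * distv y (argminset (Fobj f Psi))
       <= (fine (Fobj f Psi y) - minval (Fobj f Psi)) `^ theta) ->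
  (* conclusion: x^t -> x^* in Omega *)
  exists2 xs, argminset (Fobj f Psi) xs &
    forall eps, 0 < eps -> exists T : nat, forall t, (T <= t)%N ->
      normv (x t - xs) < eps.
Proof.
move=> argmin0 L0 cvxf smoothf cvxPsi properPsi lscPsi x0 gam01 beta01 m0 mM _
  Hbnd eta01 inexact backtrack xS xi0 zeta0 /andP[theta_gt theta_le] eb.
have M0 : 0 < M := lt_le_trans m0 mM.
have theta0 : 0 < theta by apply: lt_trans theta_gt; rewrite invr_gt0.
pose c := gam * (1 - eta) * Num.min 1 (beta * (m / (2 * L))).
have c0 : 0 < c.
  have [gam0 _] := andP gam01; have [beta0 _] := andP beta01.
  have [_ eta1] := andP eta01.
  rewrite !mulr_gt0 ?subr_gt0 // lt_min ltr01.
  by rewrite mulr_gt0 // divr_gt0 // mulr_gt0.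
pose Qs t := fine (Qopt g Psi (H t) (x t)).
pose delta t := fine (Fobj f Psi (x t)) - minval (Fobj f Psi).
have step t : Psi (x t) \is a fin_num ->
    [/\ Psi (x t.+1) \is a fin_num,
        m * normv (x t.+1 - x t) ^+ 2 <= 8 * - Qs t &
        c * - Qs t <= delta t - delta t.+1].
  move=> dx; have [d s F] := inexact_armijo_step f g L Psi cvxf smoothf cvxPsi
    properPsi argmin0 (H t) m M (x t) L0 m0 dx (Hbnd t) (p t) gam beta eta
    (alpha t) gam01 beta01 eta01 (inexact t) (backtrack t).
  rewrite /delta /Qs xS; split=> //; first by rewrite addrC addKr.
  by rewrite opprB addrA subrK.
have dx t : Psi (x t) \is a fin_num.
  by elim: t => [|t /step[]//]; exact: lty_fin_num_Psi.
have delta0 t : 0 <= delta t by rewrite subr_ge0 minval_le.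
have Qs0 t : 0 <= - Qs t.
  by rewrite oppr_ge0; apply: (@Qopt_le0 _ _ f _ L) (Hbnd t).
have deltaS t : delta t.+1 <= delta t.
  have [_ _ h] := step _ (dx t); rewrite -subr_ge0; apply: le_trans h.
  by rewrite mulr_ge0 // ltW.
have gap t B : 0 < B -> distv (x t) (argminset (Fobj f Psi)) <= B ->
    2^-1 * delta t * Num.min 1 (delta t / (4 * M * B ^+ 2)) <= - Qs t.
  exact: (Qopt_gap_dist f g L Psi cvxf smoothf cvxPsi properPsi argmin0 (H t)
    m M (x t) L0 m0 (dx t) (Hbnd t) B M0).
have small eps : 0 < eps ->
    exists T : nat, forall t, (T <= t)%N -> delta t <= eps.
  (* Capping the level at [xi] keeps it inside the range of the error bound. *)
  move=> eps0; pose e := Num.min eps xi.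
  have e0 : 0 < e by rewrite lt_min eps0.
  have exi : 0 < e <= xi by rewrite e0 ge_min lexx orbT.
  have pe0 : 0 < e `^ theta by exact: powR_gt0.
  pose K := e `^ theta / (zeta * e).
  have K0 : 0 < K by rewrite divr_gt0 // mulr_gt0.
  have K2 : 0 < 4 * M * K ^+ 2 by rewrite mulr_gt0 ?(exprn_gt0 2 K0) // mulr_gt0.
  (* With distance at most [K * delta t], the gap estimate is half of the minimum of [delta t] and a
     constant. Above level [e] this stays at least [k], so each step decreases the gap by a fixed
     amount. *)
  pose k := 2^-1 * Num.min e (4 * M * K ^+ 2)^-1.
  have k0 : 0 < k by rewrite mulr_gt0 ?invr_gt0 // lt_min e0 invr_gt0.
  have dec t : e < delta t -> delta t.+1 <= delta t - c * k.
    move=> et; have d0 : 0 < delta t := lt_trans e0 et.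
    have distK : distv (x t) (argminset (Fobj f Psi)) <= K * delta t.
      rewrite mulrAC ler_pdivlMr ?mulr_gt0 // mulrC.
      exact: (error_bound_outside f Psi cvxf cvxPsi properPsi argmin0 xi zeta
        theta zeta0 theta0 eb).
    have := gap t _ (mulr_gt0 K0 d0) distK; rewrite -mulrA.
    have -> : delta t * Num.min 1 (delta t / (4 * M * (K * delta t) ^+ 2)) =
        Num.min (delta t) (4 * M * K ^+ 2)^-1.
      rewrite minr_pMr ?(ltW d0) // mulr1; congr Num.min.
      by field; rewrite !gt_eqF.
    move=> kQ; have kk : k <= - Qs t.
      apply: le_trans kQ; rewrite ler_pM2l ?invr_gt0 //.
      by rewrite le_min ge_min (ltW et) /= ge_min lexx orbT.
    have [_ _ h] := step _ (dx t).
    have := ler_wpM2l (ltW c0) kk; lra.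
  have [T hT] := decrease_eventually_le delta e _ (mulr_gt0 c0 k0) delta0 deltaS dec.
  by exists T => t /hT /le_trans; apply; rewrite ge_min lexx.
(* From [T0] on, the error bound holds at every iterate, so only this tail is measured by the
   potential. *)
have [T0 hT0] := small _ xi0.
pose C := Num.sqrt (8 / (m * (2^-1 * Num.min 1 (zeta ^+ 2 / (4 * M))))) / c.
pose W t := C * (delta t `^ 2^-1 / 2^-1 + delta t `^ theta / theta).
have len t : normv (x (T0 + t).+1 - x (T0 + t)%N)
    <= W (T0 + t)%N - W (T0 + t).+1.
  have [_ s d] := step _ (dx (T0 + t)%N).
  apply: (step_le_potential _ _ c m M zeta theta _ (- Qs (T0 + t)%N)) => //.
  - by rewrite theta0.
  - exact: normv_ge0.
  - move=> d0; apply: gap; first by rewrite divr_gt0 // powR_gt0.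
    rewrite ler_pdivlMr // mulrC; apply: eb.
    rewrite Fobj_fin // lee_fin -fine_Fobj //.
    by have := hT0 _ (leq_addr t T0); rewrite /delta; lra.
have W0 t : 0 <= W t.
  rewrite mulr_ge0 ?divr_ge0 ?sqrtr_ge0 ?(ltW c0) // addr_ge0 //.
    by rewrite divr_ge0 ?powR_ge0 // invr_ge0.
  by rewrite divr_ge0 ?powR_ge0 // ltW.
have [|xs xsP] := finite_length_cvg (fun t => x (T0 + t)%N)
  (fun t => W (T0 + t)%N) (fun t => W0 _).
  by move=> t; rewrite addnS.
have xxs eps : 0 < eps -> exists T : nat, forall t, (T <= t)%N ->
    normv (x t - xs) < eps.
  move=> /xsP[T hT]; exists (T0 + T)%N => t Tt.
  have T0t : (T0 <= t)%N by apply: leq_trans Tt; exact: leq_addr.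
  by have := hT (t - T0)%N; rewrite subnKC //; apply; rewrite leq_subRL.
exists xs => //; exact: (limit_in_argmin f g L) xxs small.
Qed.
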